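(* Let $k\ge 1$ be an integer. For either choice of sign, the residual of GMRES applied to the preconditioned system with coefficient matrix $\mathcal{A}\mathcal{P}_{U^{\pm}}^{-1}$ (with nonzero initial residual $\mathbf{r}_0$) is bounded by $$\frac{\|\mathbf{r}_k\|}{\|\mathbf{r}_0\|}\le\left(1+\|CA^{-1}\|+\|S\hat S^{-1}\|\right)\min_{\substack{p\in\mathbb{P}_{k-1}\\ p(0)=1}}\|p(S\hat S^{-1})\|,$$ where $\mathbb{P}_{k-1}$ denotes the set of polynomials of degree up to $k-1$.
   Context: Consider a general saddle point matrix $$\mathcal{A}=\begin{bmatrix}A&B^T\\C&-D\end{bmatrix},$$ with $A\in\mathbb{R}^{n\times n}$ nonsingular, $B,C\in\mathbb{R}^{m\times n}$, $D\in\mathbb{R}^{m\times m}$. No symmetry is assumed, $B$ and $C$ need not have full rank, and the Schur complement need not be nonsingular. Put $S=D+CA^{-1}B^T$. Let $\hat S\in\mathbb{R}^{m\times m}$ be nonsingular (an approximation to $S$) and $$\mathcal{P}_{U^{\pm}}=\begin{bmatrix}A&B^T\\0&\pm\hat S\end{bmatrix}.$$ $\|\cdot\|$ is the Euclidean vector norm and the induced matrix norm. $\mathbf{r}_k$ is the residual after $k$ steps of (unrestarted) GMRES for a linear system with coefficient matrix $\mathcal{A}\mathcal{P}_{U^{\pm}}^{-1}$: $\|\mathbf{r}_k\|=\min\{\|p(\mathcal{A}\mathcal{P}_{U^{\pm}}^{-1})\mathbf{r}_0\|:\ p\in\mathbb{P}_k,\ p(0)=1\}$. *)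

(* Defs.v *)
From mathcomp Require Import all_boot all_order all_algebra.
From mathcomp Require Import boolp classical_sets reals.

Set Implicit Arguments.
Unset Strict Implicit.
Unset Printing Implicit Defensive.

Import Order.TTheory GRing.Theory Num.Theory.

Local Open Scope classical_set_scope.
Local Open Scope ring_scope.

Definition euclid_norm (R : realType) (n : nat) (x : 'cV[R]_n) : R :=
  Num.sqrt (\sum_i x i 0 ^+ 2).

(* The set is nonempty and bounded above, so this [sup] is never the junk
   value of [sup]. *)
Definition induced_norm (R : realType) (m n : nat) (A : 'M[R]_(m, n)) : R :=
  sup [set euclid_norm (A *m x) | x in [set x : 'cV[R]_n | euclid_norm x <= 1]].

Definition is_min (R : realType) (E : set R) (mu : R) : Prop :=
  E mu /\ lbound E mu.

(* Polynomials of degree at most d with value 1 at 0; recall that [size p] is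
   the degree of p plus one. *)
Definition residual_polys (R : realType) (d : nat) : set {poly R} :=
  [set p : {poly R} | (size p <= d.+1)%N /\ p.[0] = 1].

(* rk is the residual after k steps of unrestarted GMRES with coefficient
   matrix M and initial residual r0: the element of minimal norm among the
   p(M) r0, which are exactly the residuals b - M x with x in x0 + K_k(M, r0)
   when r0 = b - M x0. *)
Definition gmres_residual (R : realType) (N : nat) (M : 'M[R]_N.+1)
    (r0 : 'cV[R]_N.+1) (k : nat) (rk : 'cV[R]_N.+1) : Prop :=
  let residuals := [set horner_mx M p *m r0 | p in residual_polys k] in
  residuals rk /\ is_min [set euclid_norm r | r in residuals] (euclid_norm rk).

Definition saddle_mx (R : realType) (n m : nat) (A : 'M[R]_n)
    (B C : 'M[R]_(m, n)) (D : 'M[R]_m) : 'M[R]_(n + m) :=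
  block_mx A B^T C (- D).

Definition schur_mx (R : realType) (n m : nat) (A : 'M[R]_n)
    (B C : 'M[R]_(m, n)) (D : 'M[R]_m) : 'M[R]_m :=
  D + C *m invmx A *m B^T.

(* The sign of the trailing block is + for s = false and - for s = true. *)
Definition upper_precond (R : realType) (n m : nat) (s : bool) (A : 'M[R]_n)
    (B : 'M[R]_(m, n)) (Shat : 'M[R]_m) : 'M[R]_(n + m) :=
  block_mx A B^T 0 ((-1) ^+ s *: Shat).

(* Main.v *)
(* The preconditioned matrix is block lower triangular, [[I, 0], [E, e Z]] with
   E = C A^-1, Z = S Shat^-1 and e = -1 or 1. Given p with p(0) = 1, take the
   GMRES polynomial q(X) = (1 - X) p(e X): the factor 1 - X annihilates the
   block I, so q of the matrix is [[0, 0], [- p(Z) E, p(Z) (I - e Z)]], whose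
   norm is at most (1 + |E| + |Z|) |p(Z)|. *)
Require Import Defs.
From mathcomp Require Import all_boot all_order all_algebra.
From mathcomp Require Import boolp classical_sets reals.
From mathcomp Require Import topology normedtype derive.
From mathcomp Require Import ring lra.

Set Implicit Arguments.
Unset Strict Implicit.
Unset Printing Implicit Defensive.

Import Order.TTheory GRing.Theory Num.Theory.
Import numFieldNormedType.Exports.

Local Open Scope classical_set_scope.
Local Open Scope ring_scope.

(** * Euclidean norm of column vectors *)

Lemma euclid_norm_ge0 (R : realType) n (x : 'cV[R]_n) : 0 <= euclid_norm x.
Proof. exact: sqrtr_ge0. Qed.

Lemma sqr_euclid_norm (R : realType) n (x : 'cV[R]_n) :
  euclid_norm x ^+ 2 = \sum_i x i 0 ^+ 2.
Proof. by rewrite sqr_sqrtr// sumr_ge0// => i _; exact: sqr_ge0. Qed.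

Lemma le_coord_euclid_norm (R : realType) n (x : 'cV[R]_n) i :
  `|x i 0| <= euclid_norm x.
Proof.
rewrite -ler_sqr ?nnegrE ?euclid_norm_ge0// sqr_euclid_norm real_normK ?num_real//.
by rewrite (bigD1 i)//= lerDl sumr_ge0// => j _; exact: sqr_ge0.
Qed.

Lemma euclid_norm0 (R : realType) n : euclid_norm (0 : 'cV[R]_n) = 0.
Proof.
by rewrite /euclid_norm big1 ?sqrtr0// => i _; rewrite mxE expr0n.
Qed.

Lemma euclid_norm_eq0 (R : realType) n (x : 'cV[R]_n) :
  (euclid_norm x == 0) = (x == 0).
Proof.
apply/eqP/eqP => [x0|->]; last exact: euclid_norm0.
apply/colP => i; rewrite mxE; apply/eqP.
by rewrite -normr_le0 -x0 le_coord_euclid_norm.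
Qed.

Lemma euclid_normZ (R : realType) n (a : R) (x : 'cV[R]_n) :
  euclid_norm (a *: x) = `|a| * euclid_norm x.
Proof.
rewrite /euclid_norm -sqrtr_sqr -sqrtrM ?sqr_ge0// mulr_sumr.
by congr Num.sqrt; apply: eq_bigr => i _; rewrite mxE exprMn.
Qed.

Lemma euclid_normN (R : realType) n (x : 'cV[R]_n) :
  euclid_norm (- x) = euclid_norm x.
Proof. by rewrite -scaleN1r euclid_normZ normrN1 mul1r. Qed.

(** With [a] and [b] the norms of [x] and [y], the sum of the squares [(b x_i - a y_i) ^+ 2] equals
    [2ab] times the gap between the two sides. Zero vectors are treated first so that [2ab] is
    positive and can be cancelled. *)
Lemma cauchy_schwarz_euclid (R : realType) n (x y : 'cV[R]_n) :
  \sum_i x i 0 * y i 0 <= euclid_norm x * euclid_norm y.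
Proof.
have [->|x0] := eqVneq x 0.
  by rewrite euclid_norm0 mul0r big1// => i _; rewrite mxE mul0r.
have [->|y0] := eqVneq y 0.
  by rewrite euclid_norm0 mulr0 big1// => i _; rewrite mxE mulr0.
set a := euclid_norm x; set b := euclid_norm y.
have a0 : 0 < a by rewrite lt_neqAle eq_sym euclid_norm_eq0 x0 euclid_norm_ge0.
have b0 : 0 < b by rewrite lt_neqAle eq_sym euclid_norm_eq0 y0 euclid_norm_ge0.
have ab0 : 0 < a * b *+ 2 by rewrite pmulrn_lgt0// mulr_gt0.
rewrite -(ler_pM2l ab0) mulr_sumr.
have -> : a * b *+ 2 * (a * b) =
    \sum_i (b ^+ 2 * x i 0 ^+ 2 + a ^+ 2 * y i 0 ^+ 2).
  by rewrite big_split/= -!mulr_sumr -!sqr_euclid_norm -/a -/b; ring.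
apply: ler_sum => i _; rewrite -subr_ge0.
suff -> : b ^+ 2 * x i 0 ^+ 2 + a ^+ 2 * y i 0 ^+ 2
    - a * b *+ 2 * (x i 0 * y i 0) = (b * x i 0 - a * y i 0) ^+ 2.
  exact: sqr_ge0.
by ring.
Qed.

Lemma ler_euclid_normD (R : realType) n (x y : 'cV[R]_n) :
  euclid_norm (x + y) <= euclid_norm x + euclid_norm y.
Proof.
rewrite -ler_sqr ?nnegrE ?addr_ge0 ?euclid_norm_ge0// sqrrD !sqr_euclid_norm.
have -> : \sum_i (x + y) i 0 ^+ 2 =
    \sum_i x i 0 ^+ 2 + (\sum_i x i 0 * y i 0) *+ 2 + \sum_i y i 0 ^+ 2.
  rewrite -sumrMnl -!big_split/=.
  by apply: eq_bigr => i _; rewrite mxE sqrrD.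
by rewrite lerD2r lerD2l lerMn2r/= cauchy_schwarz_euclid.
Qed.

Lemma ler_euclid_norm_sum (R : realType) n (x : 'cV[R]_n) :
  euclid_norm x <= \sum_i `|x i 0|.
Proof.
have S0 : 0 <= \sum_i `|x i 0| by rewrite sumr_ge0.
rewrite -ler_sqr ?nnegrE ?euclid_norm_ge0// sqr_euclid_norm expr2 mulr_suml.
apply: ler_sum => i _; rewrite -real_normK ?num_real// expr2.
by rewrite ler_wpM2l// (bigD1 i)//= lerDl sumr_ge0.
Qed.

Lemma sqr_euclid_norm_col_mx (R : realType) n m (x : 'cV[R]_n) (y : 'cV[R]_m) :
  euclid_norm (col_mx x y) ^+ 2 = euclid_norm x ^+ 2 + euclid_norm y ^+ 2.
Proof.
rewrite !sqr_euclid_norm big_split_ord/=.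
by congr (_ + _); apply: eq_bigr => i _; rewrite ?col_mxEu ?col_mxEd.
Qed.

Lemma le_euclid_norm_usub (R : realType) n m (x : 'cV[R]_n) (y : 'cV[R]_m) :
  euclid_norm x <= euclid_norm (col_mx x y).
Proof.
by rewrite -ler_sqr ?nnegrE ?euclid_norm_ge0// sqr_euclid_norm_col_mx lerDl sqr_ge0.
Qed.

Lemma le_euclid_norm_dsub (R : realType) n m (x : 'cV[R]_n) (y : 'cV[R]_m) :
  euclid_norm y <= euclid_norm (col_mx x y).
Proof.
by rewrite -ler_sqr ?nnegrE ?euclid_norm_ge0// sqr_euclid_norm_col_mx lerDr sqr_ge0.
Qed.

Lemma euclid_norm_col_mx0 (R : realType) n m (y : 'cV[R]_m) :
  euclid_norm (col_mx (0 : 'cV[R]_n) y) = euclid_norm y.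
Proof.
apply/eqP; rewrite -(@eqrXn2 _ 2) ?euclid_norm_ge0//.
by rewrite sqr_euclid_norm_col_mx euclid_norm0 expr0n add0r.
Qed.

(** * Induced norm compared with the entrywise maximum norm *)

Lemma ler_mx_entry (R : realType) m n (A : 'M[R]_(m, n)) i j :
  `|A i j| <= `|A|.
Proof.
rewrite [leRHS]/Num.norm/= mx_normrE.
by apply/bigmax_geP; right; exists (i, j).
Qed.

Lemma ler_mx_norm (R : realType) m n (A : 'M[R]_(m, n)) c :
  0 <= c -> (forall i j, `|A i j| <= c) -> `|A| <= c.
Proof.
move=> c0 Ac; rewrite [leLHS]/Num.norm/= mx_normrE.
by apply/bigmax_leP; split => // -[i j] _; exact: Ac.
Qed.

(** Here [|A|] is the largest absolute value of an entry. The constant is crude but sufficient: it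
    serves only to bound the set whose supremum is [induced_norm] and to make [induced_norm]
    Lipschitz. *)
Lemma euclid_norm_mulmx_mx_norm (R : realType) m n (A : 'M[R]_(m, n)) x :
  euclid_norm x <= 1 -> euclid_norm (A *m x) <= (m * n)%:R * `|A|.
Proof.
move=> x1; apply: le_trans (ler_euclid_norm_sum _) _.
have Ai i : `|(A *m x) i 0| <= n%:R * `|A|.
  rewrite mxE; apply: le_trans (ler_norm_sum _ _ _) _.
  have -> : n%:R * `|A| = \sum_(j < n) `|A|.
    by rewrite sumr_const card_ord mulr_natl.
  apply: ler_sum => j _; rewrite normrM -[leRHS]mulr1.
  by rewrite ler_pM ?ler_mx_entry// (le_trans (le_coord_euclid_norm _ _)).
apply: (@le_trans _ _ (\sum_(i < m) n%:R * `|A|)).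
  by apply: ler_sum => i _; exact: Ai.
by rewrite sumr_const card_ord -[leLHS]mulr_natl mulrA -natrM.
Qed.

Lemma le_induced_norm_unit (R : realType) m n (A : 'M[R]_(m, n)) x :
  euclid_norm x <= 1 -> euclid_norm (A *m x) <= induced_norm A.
Proof.
move=> x1; apply: ub_le_sup; last by exists x.
exists ((m * n)%:R * `|A|) => _ [y y1 <-].
exact: euclid_norm_mulmx_mx_norm.
Qed.

Lemma induced_norm_le (R : realType) m n (A : 'M[R]_(m, n)) c :
  (forall x, euclid_norm x <= 1 -> euclid_norm (A *m x) <= c) ->
  induced_norm A <= c.
Proof.
move=> Ac; apply: ge_sup => [|_ [x x1 <-]]; last exact: Ac.
by exists (euclid_norm (A *m 0)); exists 0 => //=; rewrite euclid_norm0.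
Qed.

Lemma induced_norm_ge0 (R : realType) m n (A : 'M[R]_(m, n)) :
  0 <= induced_norm A.
Proof.
apply: le_trans (euclid_norm_ge0 (A *m 0)) _.
by apply: le_induced_norm_unit; rewrite euclid_norm0.
Qed.

Lemma le_induced_norm (R : realType) m n (A : 'M[R]_(m, n)) x :
  euclid_norm (A *m x) <= induced_norm A * euclid_norm x.
Proof.
have [->|x0] := eqVneq x 0; first by rewrite mulmx0 !euclid_norm0 mulr0.
have nx0 : 0 < euclid_norm x.
  by rewrite lt_neqAle eq_sym euclid_norm_eq0 x0 euclid_norm_ge0.
rewrite -ler_pdivrMr// mulrC -[_^-1]ger0_norm ?invr_ge0 ?euclid_norm_ge0//.
rewrite -euclid_normZ scalemxAr le_induced_norm_unit// euclid_normZ.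
by rewrite ger0_norm ?invr_ge0 ?euclid_norm_ge0// mulVf ?gt_eqF.
Qed.

Lemma ler_induced_normD (R : realType) m n (A B : 'M[R]_(m, n)) :
  induced_norm (A + B) <= induced_norm A + induced_norm B.
Proof.
apply: induced_norm_le => x x1; rewrite mulmxDl.
apply: le_trans (ler_euclid_normD _ _) _.
by rewrite lerD// le_induced_norm_unit.
Qed.

(** Each entry is a coordinate of the image of a basis vector, which has norm 1. This is the
    coercivity that later makes sublevel sets of the induced norm bounded. *)
Lemma ler_mx_norm_induced (R : realType) m n (A : 'M[R]_(m, n)) :
  `|A| <= induced_norm A.
Proof.
apply: ler_mx_norm => [|i j]; first exact: induced_norm_ge0.
have -> : A i j = (A *m (delta_mx j 0 : 'cV_n)) i 0 by rewrite -colE mxE.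
apply: le_trans (le_coord_euclid_norm _ _) _.
apply: le_induced_norm_unit; rewrite /euclid_norm (bigD1 j)//= big1 => [|k kj].
  by rewrite mxE !eqxx expr1n addr0 sqrtr1.
by rewrite mxE (negbTE kj) expr0n.
Qed.

(** Reverse triangle inequality, with the norm of the difference estimated by the crude entrywise
    bound. *)
Lemma lipschitz_induced_norm (R : realType) m n (A B : 'M[R]_(m, n)) :
  `|induced_norm A - induced_norm B| <= (m * n)%:R * `|A - B|.
Proof.
have le1 (X Y : 'M[R]_(m, n)) :
    induced_norm X - induced_norm Y <= (m * n)%:R * `|X - Y|.
  rewrite lerBlDr -{1}(subrK Y X).
  apply: le_trans (ler_induced_normD _ _) _; rewrite lerD2r.
  by apply: induced_norm_le => x; exact: euclid_norm_mulmx_mx_norm.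
by rewrite ler_norml lerNl opprB distrC !le1 distrC le1.
Qed.

(** * Existence of the minimum over residual polynomials *)

Lemma lipschitz_continuous (R : realType) (U V : normedModType R) (f : U -> V) L :
  (forall x y, `|f x - f y| <= L * `|x - y|) -> continuous f.
Proof.
move=> fL x; apply/cvgrPdist_le => e e0; near=> y.
apply: le_trans (fL _ _) _.
(* The sign of [L] is unknown; [|L| + 1] is a positive constant by which [e] can be divided. *)
apply: (@le_trans _ _ ((`|L| + 1) * `|x - y|)).
  by rewrite ler_wpM2r// (le_trans (ler_norm _))// lerDl.
rewrite mulrC -ler_pdivlMr ?ltr_wpDl//.
near: y; apply: cvgr_dist_le; last by rewrite divr_gt0// ltr_wpDl.
exact: cvg_id.
Unshelve. all: by end_near. Qed.

Lemma mulmxr_continuous (R : realType) m n p (K : 'M[R]_(n, p)) :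
  continuous (fun x : 'M[R]_(m, n) => x *m K).
Proof.
apply: (@lipschitz_continuous _ _ _ _ (n%:R * `|K|)) => x y.
rewrite -mulmxBl; apply: ler_mx_norm => [|i j]; first by rewrite !mulr_ge0.
rewrite mxE; apply: le_trans (ler_norm_sum _ _ _) _.
have -> : n%:R * `|K| * `|x - y| = \sum_(j < n) (`|K| * `|x - y|).
  by rewrite sumr_const card_ord -[RHS]mulr_natl mulrA.
by apply: ler_sum => k _; rewrite normrM mulrC ler_pM ?ler_mx_entry.
Qed.

(** The affine subspace need not be bounded, so it is cut by the sublevel set of [f] at [x0]. The
    bound [|x| <= f x] makes the intersection bounded, hence compact, and the extreme value theorem
    applies. *)
Lemma min_affine_subspace (R : realType) n r (f : 'rV[R]_n -> R)
    (V : 'M[R]_(r, n)) (x0 : 'rV[R]_n) :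
  continuous f -> (forall x, `|x| <= f x) ->
  exists2 c, (c - x0 <= V)%MS & forall x, (x - x0 <= V)%MS -> f c <= f x.
Proof.
move=> cf fge.
pose A := [set x : 'rV[R]_n | (x - x0 <= V)%MS] `&` [set x | f x <= f x0].
have A0 : A x0 by split => /=; rewrite ?subrr ?sub0mx.
have cA : closed A.
  apply: closedI.
    (* Membership in the row space of [V] means being killed by [cokermx V], so the affine subspace
       is the preimage of a point under a continuous map. *)
    rewrite (_ : mkset _ =
        (fun x => x *m cokermx V) @^-1` [set x0 *m cokermx V]).
      apply: preimage_closed => [x _|]; first exact: mulmxr_continuous.
      by apply: accessible_closed_set1; exact/hausdorff_accessible/norm_hausdorff.
    apply/seteqP; split => x /=; rewrite submxE mulmxBl subr_eq0 => /eqP//.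
  by apply: (@preimage_closed _ _ f [set y | y <= f x0]) => [x _|];
    [exact: cf | exact: closed_le].
have bA : bounded_set A.
  exists (f x0); split=> [|M /ltW x0M x [_ /= fx]]; first exact: num_real.
  exact: le_trans (fge x) (le_trans fx x0M).
have cfA : {within A, continuous f} by exact: continuous_subspaceT.
have [c] := EVT_min_rV (ex_intro _ x0 A0) (bounded_closed_compact bA cA) cfA.
rewrite inE => -[/= cV cx0] cmin; exists c => // x xV.
(* Points outside the sublevel set have a value above [f x0], which already dominates [f c]. *)
have [fx|/ltW fx] := leP (f x) (f x0); last exact: le_trans cx0 fx.
by apply: cmin; rewrite inE.
Qed.

(** Splitting off the constant coefficient, which is the value at 0, leaves [d] free coefficients;
    this exhibits the residual polynomials as an affine space. *)
Lemma residual_polysP (R : realType) d (p : {poly R}) :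
  residual_polys d p <-> exists u : 'rV[R]_d, p = rVpoly u * 'X + 1.
Proof.
split=> [[sp p0]|[u ->]]; last first.
  split; last by rewrite !hornerE.
  rewrite (leq_trans (size_polyD _ _))// size_poly1 geq_max/= andbT.
  by rewrite (leq_trans (size_polyMleq _ _))// size_polyX addn2/= ltnS size_poly.
exists (poly_rV (drop_poly 1 p)); rewrite poly_rV_K; last first.
  by rewrite size_drop_poly leq_subLR add1n.
rewrite -[LHS](poly_take_drop 1) expr1 addrC; congr (_ + _).
apply/polyP => i; rewrite coef_take_poly coef1 -p0 horner_coef0.
by case: i.
Qed.

(* [p |-> p(Z)] need not be injective, so the minimum is sought over the matrices
   [p(Z)], which form an affine subspace, rather than over the coefficients
   of [p]. *)
Lemma residual_poly_min (R : realType) n (Z : 'M[R]_n.+1) d :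
  exists mu, is_min [set induced_norm (horner_mx Z p) | p in residual_polys d] mu.
Proof.
(* Matrices are flattened to row vectors, the setting of [min_affine_subspace]. *)
pose f (x : 'rV[R]_(n.+1 * n.+1)) := induced_norm (vec_mx x : 'M[R]_n.+1).
have cf : continuous f.
  apply: (@lipschitz_continuous _ _ _ _ (n.+1 * n.+1)%:R) => x y.
  apply: le_trans (lipschitz_induced_norm _ _) _.
  rewrite ler_wpM2l// -linearB; apply: ler_mx_norm => // i j.
  by rewrite mxE; exact: ler_mx_entry.
have fge x : `|x| <= f x.
  apply: le_trans (ler_mx_norm_induced _); apply: ler_mx_norm => // i k.
  case/mxvec_indexP: k => k l; rewrite ord1.
  by rewrite -[x]vec_mxK mxvecE vec_mxK ler_mx_entry.
(* The rows of [V] are the flattened powers [Z, Z^2, ..., Z^d]; the base point is the flattened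
   identity. *)
pose V := powers_mx Z d *m lin_mulmxr Z.
have hornerV (u : 'rV[R]_d) :
    mxvec (horner_mx Z (rVpoly u * 'X + 1)) = u *m V + mxvec 1%:M.
  rewrite rmorphD rmorphM/= horner_mx_X rmorph1 linearD/=; congr (_ + _).
  by rewrite horner_rVpoly mulmxA mul_rV_lin.
have [c cV cmin] := min_affine_subspace V (mxvec 1%:M) cf fge.
exists (f c); split=> [|_ [p /residual_polysP[u ->] <-]].
  have /submxP[u cE] := cV.
  exists (rVpoly u * 'X + 1); first by apply/residual_polysP; exists u.
  by rewrite -[horner_mx _ _]mxvecK hornerV -cE subrK.
by rewrite -[horner_mx _ _]mxvecK cmin// hornerV addrK submxMl.
Qed.

(** * The preconditioned matrix and its polynomials *)

(** Multiplying the claimed product by the preconditioner avoids inverting it blockwise. In the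
    trailing block the two signs multiply to -1, leaving [C A^-1 B^T - S = - D]. *)
Lemma precond_saddle_mxE (R : realType) n m (A : 'M[R]_n.+1)
    (B C : 'M[R]_(m.+1, n.+1)) (D Shat : 'M[R]_m.+1) s :
  A \in unitmx -> Shat \in unitmx ->
  saddle_mx A B C D *m invmx (upper_precond s A B Shat) =
  block_mx 1%:M 0 (C *m invmx A)
    (- (-1) ^+ s *: (schur_mx A B C D *m invmx Shat)).
Proof.
move=> Au Su.
have Pu : upper_precond s A B Shat \in unitmx.
  by rewrite unitmxE det_ublock unitrM -!unitmxE Au unitmxZ// unitrX// unitrN1.
apply: (canLR (mulmxK Pu)).
rewrite mulmx_block !mul1mx mul0mx !mulmx0 !addr0 mulmxKV// mul0mx addr0.
congr block_mx.
rewrite -scalemxAl -scalemxAr scalerA mulNr -expr2 sqrr_sign scaleN1r.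
by rewrite mulmxKV// /schur_mx opprD addrCA subrr addr0.
Qed.

(** Induction by Horner's scheme. The corner [E'] can stay unspecified: in the GMRES polynomial it
    only meets the zero block row of [1 - M]. *)
Lemma horner_lblock_mx (R : comNzRingType) n m (X : 'M[R]_n.+1)
    (E : 'M[R]_(m.+1, n.+1)) (T : 'M[R]_m.+1) (p : {poly R}) :
  exists E', horner_mx (block_mx X 0 E T : 'M_(n.+1 + m.+1)) p =
    block_mx (horner_mx X p) 0 E' (horner_mx T p).
Proof.
elim/poly_ind: p => [|p c [E' IH]].
  by exists 0; rewrite !rmorph0; apply/esym; exact: (block_mx0 R n.+1 m.+1 n.+1 m.+1).
exists (E' *m X + horner_mx T p *m E).
set M : 'M_(n.+1 + m.+1) := block_mx X 0 E T.
transitivity ((horner_mx M p : 'M_(n.+1 + m.+1)) *m M + c%:M).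
  by rewrite rmorphD rmorphM/= horner_mx_X horner_mx_C.
rewrite !rmorphD !rmorphM/= !horner_mx_X !horner_mx_C IH.
rewrite /M mulmx_block [c%:M in LHS](scalar_mx_block n.+1 m.+1 c) add_block_mx.
by rewrite !mulmx0 !mul0mx !addr0 add0r.
Qed.

Lemma euclid_norm_gmres_poly (R : realType) n m (E : 'M[R]_(m.+1, n.+1))
    (Z : 'M[R]_m.+1) (e : R) (p : {poly R}) (x : 'cV[R]_(n.+1 + m.+1)) :
  e ^+ 2 = 1 ->
  euclid_norm (horner_mx (block_mx 1%:M 0 E (e *: Z) : 'M_(n.+1 + m.+1))
                 ((1 - 'X) * (p \Po (e *: 'X))) *m x)
    <= (1 + induced_norm E + induced_norm Z)
       * induced_norm (horner_mx Z p) * euclid_norm x.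
Proof.
move=> e2; set M := block_mx _ _ _ _.
(* The inner scaling by [e] cancels the one in the trailing block because [e ^+ 2 = 1], so both
   signs lead to the same [p(Z)]. *)
have hornerT : horner_mx (e *: Z) (p \Po (e *: 'X)) = horner_mx Z p.
  elim/poly_ind: p => [|p c IH]; first by rewrite comp_poly0 !rmorph0.
  rewrite comp_polyD comp_polyM comp_polyX comp_polyC !rmorphD !rmorphM/=.
  by rewrite IH linearZ/= !horner_mx_X !horner_mx_C scalerA -expr2 e2 scale1r.
have [E' ME'] := horner_lblock_mx 1%:M E (e *: Z) (p \Po (e *: 'X)).
(* The factor [1 - M] is moved to the right, so that its zero first block row removes both [E'] and
   the leading block of [H]. *)
rewrite mulrC rmorphM/= rmorphB/= rmorph1 horner_mx_X ME' hornerT.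
set H : 'M_(n.+1 + m.+1) := block_mx (horner_mx 1%:M _) 0 E' _.
have -> : 1 - M = block_mx 0 0 (- E) (1%:M - e *: Z).
  rewrite -[1]/(1%:M) (scalar_mx_block n.+1 m.+1 1).
  rewrite [- M](opp_block_mx 1%:M 0 E (e *: Z)).
  rewrite [LHS](add_block_mx 1%:M 0 0 1%:M).
  by rewrite subrr oppr0 addr0 sub0r.
rewrite -[x]vsubmxK; set u := usubmx x; set v := dsubmx x.
rewrite -[(H * _) *m _]/(H *m block_mx 0 0 (- E) (1%:M - e *: Z) *m _).
rewrite -mulmxA !mul_block_col.
rewrite !mul0mx !addr0 !mulmx0 !add0r [leLHS](euclid_norm_col_mx0 n.+1).
apply: le_trans (le_induced_norm _ _) _.
rewrite -mulrA mulrCA ler_wpM2l ?induced_norm_ge0//.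
rewrite mulNmx mulmxBl mul1mx.
apply: le_trans (ler_euclid_normD _ _) _; rewrite euclid_normN.
have Eu : euclid_norm (E *m u) <= induced_norm E * euclid_norm (col_mx u v).
  apply: le_trans (le_induced_norm _ _) _.
  by rewrite ler_wpM2l ?induced_norm_ge0// le_euclid_norm_usub.
have Zv : euclid_norm (e *: Z *m v) <= induced_norm Z * euclid_norm (col_mx u v).
  have ne1 : `|e| = 1 by apply/eqP; rewrite -sqr_norm_eq1 e2.
  rewrite -scalemxAl euclid_normZ ne1 mul1r.
  apply: le_trans (le_induced_norm _ _) _.
  by rewrite ler_wpM2l ?induced_norm_ge0// le_euclid_norm_dsub.
have := ler_euclid_normD v (- (e *: Z *m v)); rewrite euclid_normN => vZv.
have := le_euclid_norm_dsub u v.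
(* The three terms [E u], [v] and [e Z v] are bounded by [|E|], 1 and [|Z|] times the norm of the
   whole vector, which yields the three summands of the constant. *)
by lra.
Qed.

Theorem lemmaA2 (R : realType) (n m : nat)
    (A : 'M[R]_n.+1) (B C : 'M[R]_(m.+1, n.+1)) (D Shat : 'M[R]_m.+1)
    (A_unit : A \in unitmx) (Shat_unit : Shat \in unitmx)
    (s : bool) (k : nat) (k_ge1 : (1 <= k)%N)
    (r0 rk : 'cV[R]_(n.+1 + m.+1)) (r0_neq0 : r0 != 0)
    (rkP : gmres_residual
      (saddle_mx A B C D *m invmx (upper_precond s A B Shat)) r0 k rk) :
  let S := schur_mx A B C D in
  exists2 mu : R,
    is_min [set induced_norm (horner_mx (S *m invmx Shat) p)
           | p in residual_polys k.-1] mu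
    & euclid_norm rk / euclid_norm r0
      <= (1 + induced_norm (C *m invmx A) + induced_norm (S *m invmx Shat))
         * mu.
Proof.
move=> S; have [mu muP] := residual_poly_min (S *m invmx Shat) k.-1.
exists mu => //; case: muP => -[p [sp p0] <-] _.
have r0_gt0 : 0 < euclid_norm r0.
  by rewrite lt_neqAle eq_sym euclid_norm_eq0 r0_neq0 euclid_norm_ge0.
rewrite ler_pdivrMr//.
pose e : R := - (-1) ^+ s.
have e2 : e ^+ 2 = 1 by rewrite sqrrN sqrr_sign.
apply: le_trans (euclid_norm_gmres_poly _ _ _ _ e2).
(* GMRES minimality is tested against the single polynomial [(1 - X) p(e X)], with [p] attaining
   [mu]. *)
have [_ [_ rkmin]] := rkP; apply: rkmin.
exists (horner_mx (saddle_mx A B C D *m invmx (upper_precond s A B Shat))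
          ((1 - 'X) * (p \Po (e *: 'X))) *m r0); last first.
  by rewrite precond_saddle_mxE ?A_unit ?Shat_unit.
exists ((1 - 'X) * (p \Po (e *: 'X))) => //; split; last first.
  by rewrite hornerM horner_comp !hornerE p0 subr0 mulr1.
(* Since [e] is nonzero, composing with [e X] preserves the degree; the factor [1 - X] raises the
   bound from [k - 1] to [k], where [k >= 1] gives [k.-1.+1 = k]. *)
have e0 : e != 0 by apply: contra_eq_neq e2 => ->; rewrite expr0n eq_sym oner_eq0.
apply: leq_trans (size_polyMleq _ _) _.
rewrite size_comp_poly2 ?size_scale ?size_polyX//.
have -> : size (1 - 'X : {poly R}) = 2%N by rewrite -opprB size_polyN size_XsubC.
by move: sp; rewrite (prednK k_ge1) add2n.
Qed.
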